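(* Let $\mathcal{T}$ be a one-dimensional tiling and let $n$ be the number of equivalence classes of consecutive pairs of tiles. Then the universal group of the connected tiling semigroup of $\mathcal{T}$ is the free group generated by $n$ elements.
   Context: A one-dimensional tiling is a bi-infinite string $\mathcal{T}:\mathbb{Z}\to\Sigma$ over an alphabet $\Sigma$ (a non-empty set). Consecutive pairs of tiles at positions $(i,i+1)$ and $(j,j+1)$ are equivalent if $\mathcal{T}(i)=\mathcal{T}(j)$ and $\mathcal{T}(i+1)=\mathcal{T}(j+1)$, so $n$ is the number of distinct strings of length 2 occurring in $\mathcal{T}$. Let $L=L(\mathcal{T})$ be the set of finite non-empty strings occurring in $\mathcal{T}$. The connected tiling semigroup of $\mathcal{T}$ is the following semigroup $S(L)$ with partial operation. Its elements are strings from $L$ with one letter carrying a grave accent (the out-letter) and one letter carrying an acute accent (the in-letter); the two marked positions may be in any order and may coincide, in which case the letter is marked with a check. Thus the elements are the strings $x\check{a}y$ with $xay\in L$, and $u\grave{a}v\acute{b}w$, $u\acute{a}v\grave{b}w$ with $uavbw\in L$ ($a,b\in\Sigma$, $x,y,u,v,w\in\Sigma^*$). Product $p\otimes q$: place $p$ above $q$ so that the in-letter of $p$ is above the out-letter of $q$. If, ignoring accents, the strings agree on their overlap, glue them along the overlap, erase the in-accent of $p$ and the out-accent of $q$, and keep the other two accents (rewriting a coinciding grave and acute as a check). If the result lies in $S(L)$ (i.e. its underlying string is in $L$) it is $p\otimes q$; in all other cases $p\otimes q$ is undefined. Universal group: for a set $S$ with a partial binary operation $\circ$, the universal group of $S$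 is the quotient of the free group on $S$ by the congruence generated by all pairs $((s)\cdot(t),(s\circ t))$ with $s\circ t$ defined. *)

(* Defs.v *)
(* World: MathComp, with the classical layer of MathComp-Analysis. *)
From HB Require Import structures.
From mathcomp Require Import all_boot all_order all_algebra.
From mathcomp Require Import boolp classical_sets functions cardinality.

Set Implicit Arguments.
Unset Strict Implicit.
Unset Printing Implicit Defensive.

Import GRing.Theory.

Local Open Scope classical_set_scope.

Section GeneratedCongruence.
Variables (M : Type) (op : M -> M -> M) (r : M -> M -> Prop).

Inductive gencong : M -> M -> Prop :=
| gencong_gen x y : r x y -> gencong x y
| gencong_refl x : gencong x x
| gencong_sym x y : gencong x y -> gencong y x
| gencong_trans x y z : gencong x y -> gencong y z -> gencong x z
| gencong_op x x' y y' :
    gencong x x' -> gencong y y' -> gencong (op x y) (op x' y').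

Definition gencongb (x y : M) : bool := `[< gencong x y >].

Lemma gencongb_refl : reflexive gencongb.
Proof. by move=> x; apply/asboolP; exact: gencong_refl. Qed.

Lemma gencongb_sym : symmetric gencongb.
Proof. by move=> x y; apply/asboolP/asboolP; exact: gencong_sym. Qed.

Lemma gencongb_trans : transitive gencongb.
Proof.
by move=> y x z /asboolP xy /asboolP yz; apply/asboolP; exact: gencong_trans yz.
Qed.

Definition gencong_equiv : equiv_rel M :=
  EquivRel gencongb gencongb_refl gencongb_sym gencongb_trans.

End GeneratedCongruence.

Section QuotientGroup.
Variables (G : groupType) (r : G -> G -> Prop).
Local Open Scope group_scope.
Local Open Scope quotient_scope.

Let e := gencong_equiv ( *%g : G -> G -> G) r.

Definition quotient_group : Type := {eq_quot e}.
HB.instance Definition _ := Choice.on quotient_group.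
HB.instance Definition _ := EqQuotient.on quotient_group.

Lemma quotient_groupP (x y : G) :
  gencong *%g r x y <-> x = y %[mod quotient_group].
Proof. by split=> [h|/eqmodP/asboolP//]; apply/eqmodP/asboolP. Qed.

Definition qmul (a b : quotient_group) : quotient_group :=
  \pi_quotient_group (repr a * repr b).
Definition qone : quotient_group := \pi_quotient_group 1.
Definition qinv (a : quotient_group) : quotient_group :=
  \pi_quotient_group (repr a)^-1.

Lemma qmul_pi x y :
  qmul (\pi_quotient_group x) (\pi_quotient_group y) =
  \pi_quotient_group (x * y).
Proof.
have h z : gencong *%g r z (repr (\pi_quotient_group z)).
  by apply/quotient_groupP; rewrite reprK.
by apply/esym/quotient_groupP; exact: gencong_op.
Qed.

Lemma qmulA : associative qmul.
Proof.
move=> a b c; rewrite -[a]reprK -[b]reprK -[c]reprK.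
by rewrite (qmul_pi (repr a) (repr b)) (qmul_pi (repr b) (repr c)) !qmul_pi mulgA.
Qed.

Lemma qmul1 : left_id qone qmul.
Proof. by move=> a; rewrite -[a]reprK qmul_pi mul1g. Qed.

Lemma qmulr1 : right_id qone qmul.
Proof. by move=> a; rewrite -[a]reprK qmul_pi mulg1. Qed.

Lemma qmulV : left_inverse qone qinv qmul.
Proof. by move=> a; rewrite -[X in qmul _ X]reprK qmul_pi mulVg. Qed.

Lemma qmulrV : right_inverse qone qinv qmul.
Proof. by move=> a; rewrite -[X in qmul X _]reprK qmul_pi mulgV. Qed.

HB.instance Definition _ :=
  isGroup.Build quotient_group qmulA qmul1 qmulr1 qmulV qmulrV.

End QuotientGroup.

Section FreeGroup.
Variable X : Type.
Local Open Scope quotient_scope.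

(* The letter (x, true) stands for x and (x, false) for its inverse. *)
Definition gword := seq ({classic X} * bool).

Definition cancel_rel (u v : gword) : Prop :=
  exists x b, u = [:: (x, b); (x, ~~ b)] /\ v = [::].

Let e := gencong_equiv (@cat _) cancel_rel.

Definition free_group : Type := {eq_quot e}.
HB.instance Definition _ := Choice.on free_group.
HB.instance Definition _ := EqQuotient.on free_group.

Lemma free_groupP (u v : gword) :
  gencong (@cat _) cancel_rel u v <-> u = v %[mod free_group].
Proof. by split=> [h|/eqmodP/asboolP//]; apply/eqmodP/asboolP. Qed.

Definition gword_inv (u : gword) : gword := rev [seq (l.1, ~~ l.2) | l <- u].

Lemma gword_mulrV u : gencong (@cat _) cancel_rel (u ++ gword_inv u) [::].
Proof.
elim: u => [|[x b] u IH]; first exact: gencong_refl.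
have -> : ((x, b) :: u) ++ gword_inv ((x, b) :: u) =
    [:: (x, b)] ++ ((u ++ gword_inv u) ++ [:: (x, ~~ b)]).
  by rewrite /gword_inv /= rev_cons -cats1 catA.
apply: (@gencong_trans _ _ _ _ ([:: (x, b)] ++ ([::] ++ [:: (x, ~~ b)]))).
  by do 2?[apply: gencong_op => //]; exact: gencong_refl.
by apply: gencong_gen; exists x, b.
Qed.

Lemma gword_invK : involutive gword_inv.
Proof.
move=> u; rewrite /gword_inv map_rev revK -map_comp -[RHS]map_id.
by apply: eq_map => -[x b] /=; rewrite negbK.
Qed.

Lemma gword_mulV u : gencong (@cat _) cancel_rel (gword_inv u ++ u) [::].
Proof. by rewrite -{2}[u]gword_invK; exact: gword_mulrV. Qed.

Definition fmul (a b : free_group) : free_group := \pi_free_group (repr a ++ repr b).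
Definition fone : free_group := \pi_free_group [::].
Definition finv (a : free_group) : free_group :=
  \pi_free_group (gword_inv (repr a)).

Lemma fmul_pi u v :
  fmul (\pi_free_group u) (\pi_free_group v) = \pi_free_group (u ++ v).
Proof.
have h z : gencong (@cat _) cancel_rel z (repr (\pi_free_group z)).
  by apply/free_groupP; rewrite reprK.
by apply/esym/free_groupP; exact: gencong_op.
Qed.

Lemma fmulA : associative fmul.
Proof.
move=> a b c; rewrite -[a]reprK -[b]reprK -[c]reprK.
by rewrite (fmul_pi (repr a) (repr b)) (fmul_pi (repr b) (repr c)) !fmul_pi catA.
Qed.

Lemma fmul1 : left_id fone fmul.
Proof. by move=> a; rewrite -[a]reprK fmul_pi. Qed.

Lemma fmulr1 : right_id fone fmul.
Proof. by move=> a; rewrite -[a]reprK fmul_pi cats0. Qed.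

Lemma fmulV : left_inverse fone finv fmul.
Proof.
move=> a; rewrite -[X in fmul _ X]reprK fmul_pi.
by apply/free_groupP; exact: gword_mulV.
Qed.

Lemma fmulrV : right_inverse fone finv fmul.
Proof.
move=> a; rewrite -[X in fmul X _]reprK fmul_pi.
by apply/free_groupP; exact: gword_mulrV.
Qed.

HB.instance Definition _ :=
  isGroup.Build free_group fmulA fmul1 fmulr1 fmulV fmulrV.

Definition free_gen (x : X) : free_group :=
  \pi_free_group [:: (x : {classic X}, true)].

End FreeGroup.

(* A partial operation is an option-valued function; None means undefined. *)
Section UniversalGroup.
Variables (S : Type) (op : S -> S -> option S).
Local Open Scope group_scope.

Definition universal_rel (u v : free_group S) : Prop :=
  exists s t st, [/\ op s t = Some st,
    u = free_gen s * free_gen t & v = free_gen st].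

Definition universal_group : groupType := quotient_group universal_rel.

End UniversalGroup.

Definition isomorphic (G H : groupType) : Prop :=
  exists2 f : G -> H, {morph f : x y / (x * y)%g} & bijective f.

Section Tiling.
Variable Sigma : Type.

Definition language (T : int -> Sigma) : set (seq Sigma) :=
  [set w | w <> [::] /\
    exists i : int, w = [seq T (i + k%:Z)%R | k <- iota 0 (size w)]].

Definition pair_equiv (T : int -> Sigma) (i j : int) : Prop :=
  T i = T j /\ T (i + 1)%R = T (j + 1)%R.

(* Each class is a set of positions i, i standing for the pair (i, i + 1). The
   alphabet may be infinite, so the number of classes is a cardinal, given by
   any type in bijection with this set. *)
Definition pair_classes (T : int -> Sigma) : set (set int) :=
  range (fun i => [set j | pair_equiv T i j]).

(* Positions are counted from 0; outpos carries the grave accent and inpos the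
   acute one (both the same: a check). *)
Record marked := Marked { mstr : seq Sigma; outpos : nat; inpos : nat }.

Section TilingSemigroup.
Variable L : set (seq Sigma).

Definition in_tiling_sg (m : marked) : Prop :=
  [/\ L (mstr m), (outpos m < size (mstr m))%N & (inpos m < size (mstr m))%N].

Record tiling_sg := TilingSg {
  tsg_val :> marked;
  tsg_valP : `[< in_tiling_sg tsg_val >] }.

HB.instance Definition _ := [isSub for tsg_val].

(* The letter at position i of p lies above the letter at position j of q
   when i - inpos p = j - outpos q. *)
Definition marked_agree (p q : marked) : Prop :=
  forall i j a b, (i + outpos q = j + inpos p)%N ->
    onth (mstr p) i = Some a -> onth (mstr q) j = Some b -> a = b.

Definition longest (s t : seq Sigma) := if (size s < size t)%N then t else s.

(* On each side of the aligned letters one of the two strings extends at least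
   as far as the other, and when the strings agree it is the glued string
   there. Positions of p (resp. q) are shifted by the number of letters by
   which q (resp. p) sticks out on the left, a truncated difference. *)
Definition marked_glue (p q : marked) : marked :=
  let a := inpos p in let b := outpos q in
  Marked
    (longest (take a (mstr p)) (take b (mstr q)) ++
     longest (drop a (mstr p)) (drop b (mstr q)))
    (outpos p + (b - a)) (inpos q + (a - b)).

Definition tsg_prod (p q : tiling_sg) : option tiling_sg :=
  if `[< marked_agree p q >] then insub (marked_glue p q) else None.

End TilingSemigroup.
End Tiling.

(* Main.v *)
(* Sending a marked string with out-letter at position o and in-letter at
   position i to the product of the consecutive pairs read from o to i, each
   one inverted if i lies to the left of o, respects the partial product:
   gluing only changes the string around the path, and the paths compose.
   Conversely a marked string whose marks coincide is idempotent, hence trivial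
   in the universal group; so a marked string splits there into steps between
   neighbouring letters, and multiplying by such a trivial element identifies a
   step in any string with the same step in its two-letter string. *)
Require Import Defs.
From mathcomp Require Import all_boot all_order all_algebra zify.
From mathcomp Require Import boolp classical_sets functions cardinality.

Set Implicit Arguments.
Unset Strict Implicit.
Unset Printing Implicit Defensive.

Local Open Scope classical_set_scope.
Local Open Scope card_scope.

Section Morphisms.
Variables (G H : groupType) (f : G -> H).
Hypothesis fM : {morph f : x y / (x * y)%g}.
Local Open Scope group_scope.

Lemma morph_one : f 1 = 1.
Proof. by apply: (mulgI (f 1)); rewrite -fM !mulg1. Qed.

Lemma morph_inv : {morph f : x / x^-1}.
Proof. by move=> x; apply: (mulgI (f x)); rewrite -fM !mulgV morph_one. Qed.

End Morphisms.

Section FreeLift.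
Variables (X : Type) (G : groupType) (f : X -> G).
Local Open Scope group_scope.
Local Open Scope quotient_scope.

Definition word_eval (u : gword X) : G :=
  \prod_(l <- u) (if l.2 then f l.1 else (f l.1)^-1).

Lemma word_eval_cong u v :
  gencong (@cat _) (@cancel_rel X) u v -> word_eval u = word_eval v.
Proof.
elim=> {u v} // [u v [x [b [-> ->]]]|u v w _ -> _ ->//|u u' v v' _ eu _ ev].
  rewrite /word_eval !big_cons !big_nil mulg1 /=.
  by case: b; rewrite /= ?mulgV ?mulVg.
by move: eu ev; rewrite /word_eval !big_cat /= => -> ->.
Qed.

Definition free_lift (a : free_group X) : G := word_eval (repr a).

Lemma free_lift_pi u : free_lift (\pi_(free_group X) u) = word_eval u.
Proof. by apply/word_eval_cong/free_groupP; rewrite reprK. Qed.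

Lemma free_liftM : {morph free_lift : a b / a * b}.
Proof.
move=> a b; rewrite -[a]reprK -[b]reprK.
have -> : \pi_(free_group X) (repr a) * \pi_(free_group X) (repr b) =
    \pi_(free_group X) (repr a ++ repr b) by exact: fmul_pi.
by rewrite !free_lift_pi /word_eval big_cat.
Qed.

Lemma free_lift_gen x : free_lift (free_gen x) = f x.
Proof. by rewrite free_lift_pi /word_eval big_seq1. Qed.

End FreeLift.

Lemma free_morph_ext (X : Type) (G : groupType) (f g : free_group X -> G) :
    {morph f : x y / (x * y)%g} -> {morph g : x y / (x * y)%g} ->
  (forall x, f (free_gen x) = g (free_gen x)) -> f =1 g.
Proof.
move=> fM gM fg a; rewrite -[a]reprK; elim: (repr a) => [|[x b] u IHu].
  by rewrite [LHS](morph_one fM) [RHS](morph_one gM).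
have -> : (\pi_(free_group X) ((x, b) :: u))%qT =
    ((\pi_(free_group X) [:: (x, b)])%qT * (\pi_(free_group X) u)%qT)%g.
  by rewrite [RHS](fmul_pi [:: (x, b)] u).
rewrite fM gM IHu; congr (_ * _)%g; case: b; first exact: fg.
have -> : (\pi_(free_group X) [:: (x, false)])%qT = ((free_gen x)^-1)%g.
  apply: (mulgI (free_gen x)); rewrite mulgV [LHS](fmul_pi _ [:: _]).
  by apply/free_groupP; apply: gencong_gen; exists x, true.
by rewrite (morph_inv fM) (morph_inv gM) fg.
Qed.

Section UniversalLift.
Variables (S : Type) (op : S -> S -> option S).
Local Open Scope group_scope.
Local Open Scope quotient_scope.
Local Notation U := (universal_group op).

Definition universal_pi (a : free_group S) : U :=
  \pi_(quotient_group (universal_rel op)) a.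

Definition universal_gen (s : S) : U := universal_pi (free_gen s).

Lemma universal_piM : {morph universal_pi : a b / a * b}.
Proof. by move=> a b; rewrite [RHS]qmul_pi. Qed.

Lemma universal_genM s t st :
  op s t = Some st -> universal_gen s * universal_gen t = universal_gen st.
Proof.
move=> opst; rewrite -universal_piM; apply/quotient_groupP.
by apply: gencong_gen; exists s, t, st.
Qed.

Lemma universal_morph_ext (G : groupType) (f g : U -> G) :
    {morph f : x y / x * y} -> {morph g : x y / x * y} ->
  (forall s, f (universal_gen s) = g (universal_gen s)) -> f =1 g.
Proof.
move=> fM gM fg a; rewrite -[a]reprK.
apply: (@free_morph_ext _ _ (f \o universal_pi) (g \o universal_pi)) => //=.
  by move=> x y /=; rewrite universal_piM fM.
by move=> x y /=; rewrite universal_piM gM.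
Qed.

Variables (G : groupType) (f : S -> G).
Hypothesis fM : forall s t st, op s t = Some st -> f s * f t = f st.

Definition universal_lift (a : U) : G := free_lift f (repr a).

Lemma universal_lift_pi a : universal_lift (universal_pi a) = free_lift f a.
Proof.
have cong x y : gencong *%g (universal_rel op) x y ->
    free_lift f x = free_lift f y.
  elim=> {x y} // [x y [s [t [st [opst -> ->]]]]|x y z _ -> _ ->//|].
    by rewrite free_liftM !free_lift_gen (fM opst).
  by move=> x x' y y' _ ex _ ey; rewrite !free_liftM ex ey.
by apply/cong/quotient_groupP; rewrite reprK.
Qed.

Lemma universal_liftM : {morph universal_lift : a b / a * b}.
Proof.
move=> a b.
have -> : a * b = universal_pi (repr a * repr b).
  by rewrite universal_piM /universal_pi !reprK.
by rewrite universal_lift_pi free_liftM.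
Qed.

Lemma universal_lift_gen s : universal_lift (universal_gen s) = f s.
Proof. by rewrite universal_lift_pi free_lift_gen. Qed.

End UniversalLift.

Section Gluing.
Variable Sigma : Type.
Implicit Types s t : seq Sigma.

Lemma onth_take s a k : onth (take a s) k = if k < a then onth s k else None.
Proof.
case: ltnP => [ka|ak]; last first.
  by apply: onth_default; rewrite size_take_min; lia.
rewrite -{2}(cat_take_drop a s) onth_cat size_take_min.
case: ltnP => // sk; rewrite !onth_default ?size_drop ?size_take_min //; lia.
Qed.

Lemma onth_drop s a k : onth (drop a s) k = onth s (a + k).
Proof.
case: (leqP a (size s)) => sa; last first.
  by rewrite !onth_default ?size_drop //; lia.
rewrite -[in RHS](cat_take_drop a s) onth_cat size_takel //.
by rewrite ltnNge leq_addr /= addKn.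
Qed.

Lemma size_longest s t : size (longest s t) = maxn (size s) (size t).
Proof. by rewrite /longest; case: ltnP; lia. Qed.

Lemma ex_onth s k : k < size s -> exists a, onth s k = Some a.
Proof. by rewrite -onthTE; case: (onth s k) => // a; exists a. Qed.

Definition embeds s d t := forall k, k < size s -> onth t (d + k) = onth s k.

Variables p q : marked Sigma.
Hypotheses (pq : marked_agree p q).
Hypotheses (ip : inpos p < size (mstr p)) (oq : outpos q < size (mstr q)).

Let onth_glue k : onth (mstr (marked_glue p q)) k =
  let a := inpos p in let b := outpos q in
  if k < maxn a b then
    if a < b then onth (mstr q) k else onth (mstr p) k
  else if size (mstr p) - a < size (mstr q) - b
       then onth (mstr q) (k - maxn a b + b)
       else onth (mstr p) (k - maxn a b + a).
Proof.
rewrite /= onth_cat size_longest !size_takel ?(ltnW ip) ?(ltnW oq) //.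
rewrite /longest !size_takel ?(ltnW ip) ?(ltnW oq) // !size_drop.
case: (ltnP k) => kM.
  by case: ltnP => ab; rewrite onth_take; case: ltnP => //; lia.
by case: ltnP => _; rewrite onth_drop addnC.
Qed.

Lemma embeds_gluel :
  embeds (mstr p) (outpos q - inpos p) (mstr (marked_glue p q)).
Proof.
move=> k kp; rewrite onth_glue /=; have [x px] := ex_onth kp.
have eqq j : j < size (mstr q) -> k + outpos q = j + inpos p ->
    onth (mstr q) j = onth (mstr p) k.
  move=> /ex_onth[y qy] kj; rewrite qy px; congr Some.
  by apply/esym; apply: pq kj px qy.
case: ifP => h1; case: ifP => h2; [apply: eqq|congr onth|apply: eqq|congr onth];
  lia.
Qed.

Lemma embeds_gluer :
  embeds (mstr q) (inpos p - outpos q) (mstr (marked_glue p q)).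
Proof.
move=> k kq; rewrite onth_glue /=; have [y qy] := ex_onth kq.
have eqp j : j < size (mstr p) -> j + outpos q = k + inpos p ->
    onth (mstr p) j = onth (mstr q) k.
  move=> /ex_onth[x px] jk; rewrite qy px; congr Some.
  by apply: pq jk px qy.
case: ifP => h1; case: ifP => h2; [congr onth|apply: eqp|congr onth|apply: eqp];
  lia.
Qed.

Lemma size_glue :
  size (mstr (marked_glue p q)) =
  maxn (inpos p) (outpos q) +
  maxn (size (mstr p) - inpos p) (size (mstr q) - outpos q).
Proof.
by rewrite size_cat !size_longest !size_drop !size_takel ?(ltnW ip) ?(ltnW oq).
Qed.

End Gluing.

Section Paths.
Variables (Sigma : Type) (T : int -> Sigma).
Local Notation L := (language T).

Definition occurs_at (w : seq Sigma) (p : int) :=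
  forall k, k < size w -> onth w k = Some (T (p + k%:Z)%R).

Definition window (p : int) l := [seq T (p + k%:Z)%R | k <- iota 0 l].

Lemma size_window p l : size (window p l) = l.
Proof. by rewrite size_map size_iota. Qed.

Lemma window_occurs p l : occurs_at (window p l) p.
Proof.
move=> k; rewrite size_window => kl.
rewrite onthE -map_comp (nth_map 0) ?size_iota //= nth_iota //.
Qed.

Lemma languageP w : L w <-> 0 < size w /\ exists p, occurs_at w p.
Proof.
split=> [[w0 [p ew]]|[w0 [p wp]]].
  split; first by case: w w0 {ew}.
  by exists p; rewrite ew; exact: window_occurs.
split; first by case: w w0 {wp}.
exists p; apply: eq_from_onth_le => k; rewrite size_map size_iota maxnn => kw.
by rewrite wp // (@window_occurs p (size w)) ?size_window.
Qed.

Lemma embeds_occurs s d t p :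
  d + size s <= size t -> embeds s d t -> occurs_at t p ->
  occurs_at s (p + d%:Z)%R.
Proof.
move=> dst emb tp k ks; rewrite -emb // tp; last by lia.
by congr (Some (T _)); lia.
Qed.

Section Value.
Variables (G : groupType) (g : int -> G).
Hypothesis g_pair : forall i j, pair_equiv T i j -> g i = g j.
Local Open Scope group_scope.

Definition path_prod (p : int) k : G := \prod_(0 <= j < k) g (p + j%:Z)%R.

Lemma path_prodS p k : path_prod p k.+1 = path_prod p k * g (p + k%:Z)%R.
Proof. by rewrite /path_prod big_nat_recr. Qed.

Lemma path_prodD p d k :
  path_prod p (d + k) = path_prod p d * path_prod (p + d%:Z)%R k.
Proof.
elim: k => [|k IHk].
  by rewrite addn0 /path_prod [in X in _ * X]big_geq ?mulg1.
rewrite addnS !path_prodS IHk mulgA; congr (_ * g _); lia.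
Qed.

Lemma path_prod_occurs w p p' k : occurs_at w p -> occurs_at w p' ->
  k < size w -> path_prod p k = path_prod p' k.
Proof.
move=> wp wp' kw; apply: eq_big_nat => j /andP[_ jk]; apply: g_pair; split.
  by apply: Some_inj; rewrite -wp ?wp' //; lia.
apply: Some_inj; have e x : (x + j%:Z + 1 = x + j.+1%:Z)%R by lia.
by rewrite !e -wp ?wp' //; lia.
Qed.

Definition position (m : tiling_sg L) : int :=
  xget 0%R [set p | occurs_at (mstr m) p].

Lemma tiling_sgP (m : tiling_sg L) :
  [/\ occurs_at (mstr m) (position m), outpos m < size (mstr m)
    & inpos m < size (mstr m)].
Proof.
have /asboolP[/languageP[_ [p mp]] om im] := tsg_valP m; split=> //.
exact: (@xgetPex _ 0%R [set p | occurs_at (mstr m) p] (ex_intro _ p mp)).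
Qed.

Definition path_value (m : tiling_sg L) : G :=
  (path_prod (position m) (outpos m))^-1 * path_prod (position m) (inpos m).

Lemma path_valueE (m : tiling_sg L) p : occurs_at (mstr m) p ->
  path_value m = (path_prod p (outpos m))^-1 * path_prod p (inpos m).
Proof.
have [mp0 om im] := tiling_sgP m; move=> mp; rewrite /path_value.
by congr (_^-1 * _); apply: path_prod_occurs mp _.
Qed.

Lemma path_valueM s t st :
  tsg_prod s t = Some st -> path_value s * path_value t = path_value st.
Proof.
rewrite /tsg_prod; case: asboolP => // agr; case: insubP => // x _ ex [xst].
rewrite {x}xst in ex; have [stP _ _] := tiling_sgP st.
have [_ _ is_] := tiling_sgP s; have [_ ot _] := tiling_sgP t.
have szst := size_glue is_ ot.
have eml := embeds_gluel agr is_ ot; have emr := embeds_gluer agr is_ ot.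
have P := stP; rewrite ex in P.
have sP := embeds_occurs _ eml P; have tP := embeds_occurs _ emr P.
rewrite (path_valueE (sP _)) ?szst; last by lia.
rewrite (path_valueE (tP _)) ?szst; last by lia.
rewrite (path_valueE stP).
have shift q d k :
    path_prod (q + d%:Z)%R k = (path_prod q d)^-1 * path_prod q (d + k).
  by rewrite path_prodD mulKg.
rewrite !shift ex /= !invgM !invgK.
rewrite (_ : outpos t - inpos s + inpos s = inpos s - outpos t + outpos t)%N;
  last by lia.
by rewrite -!mulgA !mulVKg [(outpos s + _)%N]addnC [(inpos t + _)%N]addnC.
Qed.

End Value.

Lemma path_prod_morph (G H : groupType) (f : G -> H) (g : int -> G) p k :
  {morph f : x y / (x * y)%g} ->
  f (path_prod g p k) = path_prod (f \o g) p k.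
Proof. by move=> fM; exact: (big_morph f fM (morph_one fM)). Qed.

Lemma step_proof p : `[< in_tiling_sg L (Marked (window p 2) 0 1) >].
Proof.
by apply/asboolP; split=> //; apply/languageP; split=> //; exists p;
  exact: window_occurs.
Qed.

Definition step p : tiling_sg L := TilingSg (step_proof p).

Lemma step_pair i j : pair_equiv T i j -> step i = step j.
Proof.
by move=> [e0 e1]; apply: val_inj; rewrite /= /window /= !GRing.addr0 e0 e1.
Qed.

Lemma path_value_step (G : groupType) (g : int -> G) p :
  (forall i j, pair_equiv T i j -> g i = g j) -> path_value g (step p) = g p.
Proof.
move=> g_pair; rewrite (@path_valueE _ _ g_pair _ p); last exact: window_occurs.
by rewrite /path_prod big_geq // big_nat1 invg1 mul1g GRing.addr0.
Qed.

Section Generation.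
Variables (G : groupType) (u : tiling_sg L -> G).
Hypothesis uM : forall s t st, tsg_prod s t = Some st -> (u s * u t = u st)%g.
Local Open Scope group_scope.

Let uext (m : marked Sigma) : G := oapp u 1 (insub m).

Let uextE s : uext (val s) = u s.
Proof. by rewrite /uext valK. Qed.

Let uextM p q : in_tiling_sg L p -> in_tiling_sg L q ->
  in_tiling_sg L (marked_glue p q) -> marked_agree p q ->
  uext p * uext q = uext (marked_glue p q).
Proof.
move=> /asboolP Lp /asboolP Lq /asboolP Lpq agr.
rewrite -[p]/(val (TilingSg Lp)) -[q]/(val (TilingSg Lq)) !uextE.
rewrite -[marked_glue _ _]/(val (TilingSg Lpq)) uextE; apply: uM.
by rewrite /tsg_prod asboolT //; exact: (valK (TilingSg Lpq)).
Qed.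

Lemma path_value_generates s : u s = path_value (u \o step) s.
Proof.
have [] := tiling_sgP s; set w := mstr s; set p := position s => wp os is_.
pose v o i := uext (Marked w o i).
have Lw : L w by apply/languageP; split; [lia|exists p].
have vM o k i : o < size w -> k < size w -> i < size w -> v o k * v k i = v o i.
  move=> ow kw iw; have glueE : marked_glue (Marked w o k) (Marked w k i) =
      Marked w o i.
    by rewrite /marked_glue /longest /= !ltnn cat_take_drop subnn !addn0.
  rewrite /v -glueE; apply: uextM; rewrite ?glueE //.
  move=> i' j a b /= /eqP; rewrite eqn_add2r => /eqP -> ea eb.
  by apply: Some_inj; rewrite -ea -eb.
have v1 k : k < size w -> v k k = 1.
  by move=> kw; apply: (mulgI (v k k)); rewrite vM // mulg1.
have vS k : k.+1 < size w -> v k k.+1 = u (step (p + k%:Z)%R).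
  move=> kw; rewrite -uextE.
  have glueE : marked_glue (Marked w k k) (val (step (p + k%:Z)%R)) =
      Marked w k k.+1.
    rewrite /marked_glue /longest /= size_drop.
    by rewrite ifF ?cat_take_drop ?sub0n ?addn0 ?subn0 //; lia.
  rewrite -[RHS]mul1g -(v1 k) /v; last by lia.
  rewrite uextM ?glueE //; do ?[by split=> //=; lia|exact/asboolP/step_proof].
  move=> i j a b /=; rewrite addn0 => -> ea eb; apply: Some_inj.
  have jw : j + k < size w by rewrite -onthTE ea.
  have j2 : j < 2 by rewrite -(size_window (p + k%:Z)%R 2) -onthTE /= eb.
  have -> : Some b = onth (window (p + k%:Z)%R 2) j by rewrite -eb.
  rewrite -ea wp // window_occurs // ?size_window //.
  by congr (Some (T _)); lia.
have v0 k : k < size w -> v 0 k = path_prod (u \o step) p k.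
  elim: k => [|k IHk] kw; first by rewrite v1 // /path_prod big_geq.
  by rewrite path_prodS -IHk 1?ltnW //= -vS // vM //; lia.
have g_pair i j : pair_equiv T i j -> (u \o step) i = (u \o step) j.
  by move=> /step_pair /= ->.
rewrite (path_valueE g_pair wp) -!v0 //.
have -> : u s = v (outpos s) (inpos s).
  by rewrite -uextE; congr uext; rewrite /w /=; case: (tsg_val s).
have w0 : 0 < size w by lia.
by apply: (mulgI (v 0 (outpos s))); rewrite mulVKg vM.
Qed.

End Generation.

Lemma pair_classes_card (n : Type) : [set: n] #= pair_classes T ->
  exists (c : int -> n) (r : n -> int),
    [/\ forall i j, pair_equiv T i j -> c i = c j, cancel r c
      & forall i, pair_equiv T (r (c i)) i].
Proof.
have pes i j : pair_equiv T i j -> pair_equiv T j i by case.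
have pet i j k : pair_equiv T i j -> pair_equiv T j k -> pair_equiv T i k.
  by move=> [e0 e1] [f0 f1]; split; rewrite (e0, e1).
have classE i j :
    pair_equiv T i j -> [set k | pair_equiv T i k] = [set k | pair_equiv T j k].
  by move=> ij; apply/seteqP; split=> k /=; apply: pet => //; exact: pes.
case/card_bijP => f [h fK hK].
pose cls i : pair_classes T :=
  SigSub (mem_set (imageT (fun i => [set j | pair_equiv T i j]) i)).
have rP (x : n) : {i | f (SigSub (mem_set (I : [set: n] x))) = cls i}.
  apply: cid; case: (f _) => A hA /=; have /set_mem[i _ iA] := hA.
  by exists i; apply: val_inj.
exists (fun i => val (h (cls i))), (fun x => projT1 (rP x)); split.
- by move=> i j /classE ij; congr (val (h _)); apply: val_inj.
- by move=> x /=; case: (rP x) => i /= <-; rewrite fK.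
- move=> i /=; case: (rP _) => j /=.
  rewrite (_ : SigSub _ = h (cls i)); last exact: val_inj.
  by rewrite hK => /(congr1 val) /= /esym/seteqP[_ /(_ i)]; apply; split.
Qed.

End Paths.

Theorem corollary4p2p4 (Sigma : Type) (T : int -> Sigma)
    (n : Type) (hn : [set: n] #= pair_classes T) :
  isomorphic (universal_group (tsg_prod (L := language T))) (free_group n).
Proof.
have [c [r [c_pair rK cK]]] := pair_classes_card hn.
pose g i := free_gen (c i).
have g_pair i j : pair_equiv T i j -> g i = g j.
  by move=> /c_pair cij; rewrite /g cij.
have gM := path_valueM g_pair.
pose ugen := @universal_gen _ (tsg_prod (L := language T)).
pose F := universal_lift (op := tsg_prod (L := language T)) (path_value g).
pose H := free_lift (fun x => ugen (step T (r x))).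
have FM : {morph F : x y / (x * y)%g} by exact: universal_liftM.
have HM : {morph H : x y / (x * y)%g} by exact: free_liftM.
exists F => //; exists H.
- apply: (@universal_morph_ext _ _ _ (H \o F) id) => // [x y|s] /=.
    by rewrite FM HM.
  rewrite [F _]universal_lift_gen // -/(ugen s).
  rewrite [RHS](path_value_generates (@universal_genM _ _)) /path_value.
  rewrite HM (morph_inv HM) !(path_prod_morph _ _ _ HM).
  suff -> : H \o g = ugen \o step T by [].
  apply/funext => i /=; rewrite /H free_lift_gen; congr ugen.
  exact/step_pair/cK.
- apply: (@free_morph_ext _ _ (F \o H) id) => // [x y|x] /=.
    by rewrite HM FM.
  rewrite /H free_lift_gen [F _]universal_lift_gen //.
  by rewrite path_value_step // /g rK.
Qed.
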